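(* Let $f\ne -z$ be any pseudo-involutory function, with B-function $B_f$ and pseudo-half $h_f=\widehat{(\sqrt{zf})}$. Then $$B_f=2h_{f,e}\qquad\text{and}\qquad h_{f,o}=\sqrt{1+zh_{f,e}^2}.$$ Moreover, if $h$ is any (compositionally) invertible power series such that $f=h\circ\widehat{h}$, then $$zB_f=(2zh_e)\circ\overline{(zh_o^2-z^2h_e^2)}.$$
   Context: $\mathcal{F}_1$ is the set of formal power series in $\mathbb{R}[[z]]$ of order exactly $1$; each $f\in\mathcal{F}_1$ has a compositional inverse $\overline{f}$. The pseudo-inverse of $f\in\mathcal{F}_1$ is $\widehat{f}=(-z)\circ\overline{f}\circ(-z)$. A function $f\in\mathcal{F}_1$ is pseudo-involutory if $\widehat{f}=f$ (equivalently, $-f$ is a compositional involution). If $f\neq -z$ is pseudo-involutory then $f'(0)=1$, and $\sqrt{zf}=z\sqrt{f/z}$ is the square root of $zf$ with leading coefficient $1$; the pseudo-half of $f$ is $h_f=\widehat{(\sqrt{zf})}$. The B-function of $f$ is the power series $B_f\in\mathbb{R}[[z]]$ defined by $f-z=zf\,B_f(zf)$, i.e. $f-z=(zB_f)\circ(zf)$. For any $h\in\mathbb{R}[[z]]$ with $h(0)=0$, the series $h_o,h_e\in\mathbb{R}[[z]]$ are defined by $h(z)=zh_o(z^2)+z^2h_e(z^2)$; $h_{f,o},h_{f,e}$ denote these series for $h=h_f$. The square root $\sqrt{1+zh_{f,e}^2}$ has constant term $1$. *)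

(* Defs.v *)
From HB Require Import structures.
From mathcomp Require Import all_boot all_order all_algebra.
From mathcomp Require Import boolp classical_sets reals zify ring.

Set Implicit Arguments.
Unset Strict Implicit.
Unset Printing Implicit Defensive.

Import Order.TTheory GRing.Theory Num.Theory.
Local Open Scope ring_scope.

(* The ring R[[z]] of formal power series: f n is the coefficient of z^n. *)
Record fps (R : Type) := FPS { fcoef :> nat -> R }.

Lemma fpsP (R : Type) (f g : fps R) : (forall n, f n = g n) <-> f = g.
Proof.
split=> [|-> //]; case: f g => [f] [g] /= fg.
by congr FPS; apply/funext.
Qed.

HB.instance Definition _ (R : Type) := gen_eqMixin (fps R).
HB.instance Definition _ (R : Type) := gen_choiceMixin (fps R).

HB.lock Definition fps_mul (R : comNzRingType) (f g : fps R) : fps R :=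
  FPS (fun n => \sum_(i < n.+1) f i * g (n - i)%N).
Arguments fps_mul {R} f g.

Section FpsRing.
Variable R : comNzRingType.
Implicit Types (f g h : fps R) (n m : nat).

Definition fps_zero : fps R := FPS (fun=> 0).
Definition fps_opp f : fps R := FPS (fun n => - f n).
Definition fps_add f g : fps R := FPS (fun n => f n + g n).
Definition fps_const (c : R) : fps R := FPS (fun n => if n == 0 then c else 0).
Lemma fps_mulE f g n : fps_mul f g n = \sum_(i < n.+1) f i * g (n - i)%N.
Proof. by rewrite fps_mul.unlock. Qed.

Lemma fps_addA : associative fps_add.
Proof. by move=> f g h; apply/fpsP => n /=; rewrite addrA. Qed.
Lemma fps_addC : commutative fps_add.
Proof. by move=> f g; apply/fpsP => n /=; rewrite addrC. Qed.
Lemma fps_add0 : left_id fps_zero fps_add.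
Proof. by move=> f; apply/fpsP => n /=; rewrite add0r. Qed.
Lemma fps_addN : left_inverse fps_zero fps_opp fps_add.
Proof. by move=> f; apply/fpsP => n /=; rewrite addNr. Qed.

HB.instance Definition _ :=
  GRing.isZmodule.Build (fps R) fps_addA fps_addC fps_add0 fps_addN.

Let trunc n f : {poly R} := \poly_(i < n.+1) f i.

Let truncE n f i : (i <= n)%N -> (trunc n f)`_i = f i.
Proof. by move=> le_in; rewrite coef_poly ltnS le_in. Qed.

Let fps_mul_trunc n m f g : (n <= m)%N ->
  fps_mul f g n = (trunc m f * trunc m g)`_n.
Proof.
move=> le_nm; rewrite fps_mulE coefM; apply: eq_bigr => i _.
rewrite !truncE //; first exact: leq_trans (leq_subr _ _) le_nm.
exact: leq_trans (leq_ord i) le_nm.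
Qed.

Let coefM_eq (p p' q q' : {poly R}) n :
  (forall i, (i <= n)%N -> p`_i = p'`_i) ->
  (forall i, (i <= n)%N -> q`_i = q'`_i) -> (p * q)`_n = (p' * q')`_n.
Proof.
move=> pp qq; rewrite !coefM; apply: eq_bigr => i _.
by rewrite pp ?leq_ord // qq // leq_subr.
Qed.

Lemma fps_mulC : commutative (@fps_mul R).
Proof.
by move=> f g; apply/fpsP => n; rewrite !(@fps_mul_trunc n n) // mulrC.
Qed.

Lemma fps_mulA : associative (@fps_mul R).
Proof.
move=> f g h; apply/fpsP => n; rewrite !(@fps_mul_trunc n n) //.
transitivity ((trunc n f * (trunc n g * trunc n h))`_n).
  by apply: coefM_eq => // i le_in; rewrite truncE // (@fps_mul_trunc i n).
rewrite mulrA; apply: coefM_eq => // i le_in.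
by rewrite truncE // (@fps_mul_trunc i n).
Qed.

Lemma fps_mul1 : left_id (fps_const 1) (@fps_mul R).
Proof.
move=> f; apply/fpsP => n; rewrite fps_mulE.
by rewrite big_ord_recl /= mul1r subn0 big1 ?addr0 // => i _; rewrite mul0r.
Qed.

Lemma fps_mulDl : left_distributive (@fps_mul R) fps_add.
Proof.
move=> f g h; apply/fpsP => n /=; rewrite !fps_mulE -big_split /=.
by apply: eq_bigr => i _; rewrite mulrDl.
Qed.

Lemma fps_one_neq0 : fps_const 1 != 0 :> fps R.
Proof. by apply/eqP => /fpsP /(_ 0%N) /= /eqP; rewrite oner_eq0. Qed.

HB.instance Definition _ := GRing.Zmodule_isComNzRing.Build (fps R)
  fps_mulA fps_mulC fps_mul1 fps_mulDl fps_one_neq0.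

Definition fps_X : fps R := FPS (fun n => (n == 1)%:R).

(* f / z, for f with zero constant term. *)
Definition fps_divX f : fps R := FPS (fun n => f n.+1).

(* The series h_o and h_e in h(z) = z h_o(z^2) + z^2 h_e(z^2), for h with zero
   constant term; see fps_oddevenP. *)
Definition fps_odd h : fps R := FPS (fun n => h n.*2.+1).
Definition fps_even h : fps R := FPS (fun n => h n.*2.+2).

End FpsRing.

(* The composite g(f(z)); the sum can stop at k = n because f^k has no term of
   degree < k. Only meaningful when f has zero constant term. *)
HB.lock Definition fps_comp (R : comNzRingType) (g f : fps R) : fps R :=
  FPS (fun n => \sum_(k < n.+1) g k * (f ^+ k) n).
Arguments fps_comp {R} g f.

Notation "''z'" := (fps_X _) : ring_scope.
Notation "g \oS f" := (fps_comp g f) (at level 50) : ring_scope.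

Section FpsTheory.
Variable R : comNzRingType.
Implicit Types (f g h a b c : fps R) (n m k : nat).

Lemma fps0E n : (0 : fps R) n = 0. Proof. by []. Qed.
Lemma fps1E n : (1 : fps R) n = (n == 0)%:R.
Proof. by case: n. Qed.
Lemma fpsXE n : ('z : fps R) n = (n == 1)%:R. Proof. by []. Qed.
Lemma fpsNE f n : (- f) n = - f n. Proof. by []. Qed.
Lemma fpsDE f g n : (f + g) n = f n + g n. Proof. by []. Qed.
Lemma fpsBE f g n : (f - g) n = f n - g n. Proof. by []. Qed.
Lemma fpsME f g n : (f * g) n = \sum_(i < n.+1) f i * g (n - i)%N.
Proof. exact: fps_mulE. Qed.
Lemma fps_compE g f n : (g \oS f) n = \sum_(k < n.+1) g k * (f ^+ k) n.
Proof. by rewrite fps_comp.unlock. Qed.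
Lemma fpsM0 f g : (f * g) 0%N = f 0%N * g 0%N.
Proof. by rewrite fpsME big_ord1. Qed.
Lemma fpsX0 f k : (f ^+ k) 0%N = f 0%N ^+ k.
Proof. by elim: k => [|k IH]; rewrite ?fps1E // exprS fpsM0 IH -exprS. Qed.
Lemma fpsCM (x : R) f n : (fps_const x * f) n = x * f n.
Proof.
rewrite fpsME big_ord_recl /= subn0 big1 ?addr0 // => i _.
by rewrite /= mul0r.
Qed.
Lemma fps_sumE (I : Type) (r : seq I) (P : pred I) (F : I -> fps R) n :
  (\sum_(i <- r | P i) F i) n = \sum_(i <- r | P i) F i n.
Proof. by elim/big_rec2: _ => // i x y _ <-. Qed.

Lemma fpsXM f n : ('z * f) n = if n is n'.+1 then f n' else 0.
Proof.
case: n => [|n]; first by rewrite fpsM0 mul0r.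
rewrite fpsME big_ord_recl /= mul0r add0r big_ord_recl /= mul1r subn1.
by rewrite big1 ?addr0 // => i _; rewrite mul0r.
Qed.

Lemma fpsXn k n : (('z : fps R) ^+ k) n = (n == k)%:R.
Proof.
elim: k n => [|k IH] n; first by rewrite fps1E.
by rewrite exprS fpsXM; case: n => [|n] //; rewrite IH.
Qed.

Lemma fps_divXK f : f 0%N = 0 -> 'z * fps_divX f = f.
Proof. by move=> f0; apply/fpsP => -[|n]; rewrite fpsXM. Qed.

Lemma fps_exp_low f k n : f 0%N = 0 -> (n < k)%N -> (f ^+ k) n = 0.
Proof.
move=> f0; elim: k n => // k IH n lt_nk; rewrite exprS fpsME big1 // => -[i /=].
rewrite ltnS => le_in _; case: i le_in => [|i] le_in; first by rewrite f0 mul0r.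
by rewrite IH ?mulr0 //; lia.
Qed.

Lemma fps_exp_diag f k : f 0%N = 0 -> (f ^+ k) k = f 1%N ^+ k.
Proof.
move=> f0; elim: k => [|k IH]; first by rewrite fps1E.
rewrite exprS fpsME big_ord_recl /= f0 mul0r add0r big_ord_recl /= subn1 /= IH.
rewrite -exprS big1 ?addr0 // => i _; rewrite fps_exp_low ?mulr0 //.
by case: i => i lt_i; rewrite /= /bump /=; lia.
Qed.

Lemma fps_mul_eq f f' g g' n :
  (forall i, (i <= n)%N -> f i = f' i) -> (forall i, (i <= n)%N -> g i = g' i) ->
  (f * g) n = (f' * g') n.
Proof.
move=> ff gg; rewrite !fpsME; apply: eq_bigr => i _.
by rewrite ff ?leq_ord // gg // leq_subr.
Qed.

Lemma fps_comp_coef g f m n : f 0%N = 0 -> (n < m)%N ->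
  (g \oS f) n = \sum_(k < m) g k * (f ^+ k) n.
Proof.
move=> f0 lt_nm; rewrite fps_compE (big_ord_widen m (fun k => g k * (f ^+ k) n)) //.
rewrite [RHS](bigID (fun k : 'I_m => (k < n.+1)%N)) /= [X in _ + X]big1 ?addr0 //.
by move=> i; rewrite -leqNgt => lt_ni; rewrite fps_exp_low ?mulr0.
Qed.

Lemma fps_comp_sum g f m n : f 0%N = 0 -> (n < m)%N ->
  (g \oS f) n = (\sum_(k < m) fps_const (g k) * f ^+ k) n.
Proof.
move=> f0 lt_nm; rewrite (fps_comp_coef g f0 lt_nm) fps_sumE.
by apply: eq_bigr => k _; rewrite fpsCM.
Qed.

Lemma fps_comp_eq g g' f n : (forall i, (i <= n)%N -> g i = g' i) ->
  (g \oS f) n = (g' \oS f) n.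
Proof. by move=> gg; rewrite !fps_compE; apply: eq_bigr => i _; rewrite gg // leq_ord. Qed.

Lemma fps_comp0 g f : (g \oS f) 0%N = g 0%N.
Proof. by rewrite fps_compE big_ord1 mulr1. Qed.

Lemma fps_comp1 g f : f 0%N = 0 -> (g \oS f) 1%N = g 1%N * f 1%N.
Proof.
move=> f0; rewrite fps_compE !big_ord_recl big_ord0 /= mulr0 add0r addr0.
by rewrite expr1.
Qed.

Lemma fps_compD g h f : (g + h) \oS f = (g \oS f) + (h \oS f).
Proof.
apply/fpsP => n; rewrite fpsDE !fps_compE -big_split /=.
by apply: eq_bigr => i _; rewrite mulrDl.
Qed.

Lemma fps_compN g f : (- g) \oS f = - (g \oS f).
Proof.
apply/fpsP => n; rewrite fpsNE !fps_compE -sumrN.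
by apply: eq_bigr => i _; rewrite mulNr.
Qed.

Lemma fps_comp_const (x : R) f : fps_const x \oS f = fps_const x.
Proof.
apply/fpsP => n; rewrite fps_compE big_ord_recl /= big1 ?addr0 => [|i _].
  by case: n => [|n]; rewrite /= ?mulr1 ?mulr0.
by rewrite mul0r.
Qed.

Lemma fps_comp_one f : 1 \oS f = 1.
Proof. exact: fps_comp_const. Qed.

Lemma fps_comp_zero f : 0 \oS f = 0.
Proof.
by apply/fpsP => n; rewrite fps_compE big1 // => i _; rewrite mul0r.
Qed.

Lemma fps_comp_X f : f 0%N = 0 -> 'z \oS f = f.
Proof.
move=> f0; apply/fpsP => n; rewrite (@fps_comp_coef _ _ n.+2) //.
rewrite !big_ord_recl /= mul0r add0r mul1r expr1 big1 ?addr0 // => i _.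
by rewrite mul0r.
Qed.

Lemma fps_compXr f : f \oS 'z = f.
Proof.
apply/fpsP => n; rewrite fps_compE big_ord_recr /= big1 ?add0r => [|i _].
  by rewrite fpsXn eqxx mulr1.
by rewrite fpsXn gtn_eqF ?mulr0.
Qed.

Lemma fps_comp_sum_distr (I : Type) (r : seq I) (F : I -> fps R) f :
  (\sum_(i <- r) F i) \oS f = \sum_(i <- r) (F i \oS f).
Proof.
elim: r => [|i r IH]; last by rewrite !big_cons fps_compD IH.
by rewrite !big_nil fps_comp_zero.
Qed.

Lemma fps_compM g h f : f 0%N = 0 -> (g * h) \oS f = (g \oS f) * (h \oS f).
Proof.
move=> f0; apply/fpsP => n.
transitivity (((\sum_(i < n.+1) fps_const (g i) * f ^+ i)
              * (\sum_(j < n.+1) fps_const (h j) * f ^+ j)) n); last first.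
  by apply: fps_mul_eq => i le_in; rewrite -fps_comp_sum.
rewrite big_distrlr /= fps_sumE.
under [RHS]eq_bigr => i _.
  rewrite fps_sumE; under eq_bigr => j _.
    rewrite mulrACA -exprD -mulrA !fpsCM.
  over.
over.
rewrite fps_compE; under [LHS]eq_bigr => k _ do rewrite fpsME mulr_suml.
under [LHS]eq_bigr => k _.
  rewrite (big_ord_widen n.+1
    (fun i => g i * h (k - i)%N * (f ^+ k) n) (ltn_ord k)).
  rewrite big_mkcond /=.
over.
rewrite exchange_big /=; apply: eq_bigr => i _.
rewrite -(big_mkord xpredT
  (fun k => if (i < k.+1)%N then g i * h (k - i)%N * (f ^+ k) n else 0)).
rewrite (big_cat_nat (n := i)) //= ?(ltnW (ltn_ord i)) //.
rewrite big_nat big1 ?add0r => [|k /andP[_ lt_ki]]; last by rewrite ltnNge lt_ki.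
rewrite -{1}[i : nat]add0n big_addn big_mkord.
rewrite [RHS](bigID (fun j : 'I_n.+1 => (j < n.+1 - i)%N)) /=.
rewrite [X in _ = _ + X]big1 ?addr0; last first.
  move=> j; rewrite -leqNgt leq_subLR => lt_nij.
  by rewrite fps_exp_low ?mulr0.
rewrite -(big_ord_widen n.+1
  (fun j => g i * (h j * (f ^+ (i + j)) n))) ?leq_subr //.
by apply: eq_bigr => j _; rewrite ltnS leq_addl addnK mulrA addnC.
Qed.

Lemma fps_compXn g f k : f 0%N = 0 -> (g ^+ k) \oS f = (g \oS f) ^+ k.
Proof.
move=> f0; elim: k => [|k IH]; first by rewrite !expr0 fps_comp_one.
by rewrite !exprS fps_compM // IH.
Qed.

Lemma fps_compA a b c : b 0%N = 0 -> c 0%N = 0 ->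
  (a \oS b) \oS c = a \oS (b \oS c).
Proof.
move=> b0 c0; apply/fpsP => n.
rewrite (@fps_comp_eq _ (\sum_(k < n.+1) fps_const (a k) * b ^+ k)); last first.
  by move=> i le_in; rewrite -fps_comp_sum.
rewrite fps_comp_sum_distr [RHS](@fps_comp_sum _ _ n.+1) ?fps_comp0 // !fps_sumE.
by apply: eq_bigr => k _; rewrite fps_compM // fps_compXn // fps_comp_const.
Qed.

Lemma fps_oddevenP h a b : h 0%N = 0 ->
  h = 'z * (a \oS 'z ^+ 2) + 'z ^+ 2 * (b \oS 'z ^+ 2)
  <-> a = fps_odd h /\ b = fps_even h.
Proof.
have X20 : ('z ^+ 2 : fps R) 0%N = 0 by rewrite fpsXn.
have compX2 c n : (c \oS 'z ^+ 2) n = if odd n then 0 else c n./2.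
  rewrite fps_compE; under eq_bigr => k _ do rewrite -exprM fpsXn.
  case: ifP => [odd_n|even_n].
    rewrite big1 // => i _; case: eqP => [en|]; last by rewrite mulr0.
    by rewrite en oddM in odd_n.
  have lt_n : (n./2 < n.+1)%N by lia.
  rewrite (bigD1 (Ordinal lt_n)) //= mul2n even_halfK ?even_n // eqxx mulr1.
  rewrite big1 ?addr0 // => i /eqP ne.
  rewrite (_ : (n == _) = false) ?mulr0 //; apply/eqP => en; apply: ne.
  by apply/val_inj => /=; lia.
have rhs (u v : fps R) n : ('z * (u \oS 'z ^+ 2) + 'z ^+ 2 * (v \oS 'z ^+ 2)) n =
  if n is m.+1 then if odd m then v m./2 else u m./2 else 0.
  have := compX2 u; have := compX2 v.
  move: (u \oS _) (v \oS _) => U V VE UE.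
  rewrite expr2 -mulrA -mulrDr fpsXM; case: n => // -[|n].
    by rewrite fpsDE UE fpsXM addr0.
  rewrite fpsDE fpsXM UE VE /= uphalf_half.
  by case: (odd n); rewrite /= ?add0r ?addr0.
move=> h0; split=> [eh|[-> ->]].
  split; apply/fpsP => n /=; rewrite eh rhs /= odd_double /=.
    by rewrite doubleK.
  by rewrite uphalf_double.
apply/fpsP => n; case: n => [|n]; first by rewrite h0 rhs.
by rewrite rhs /=; have := odd_double_half n; case: ifP => _ {1}<-.
Qed.

End FpsTheory.

Section RealSeries.
Variable R : realType.
Implicit Types (a b f g h s t B : fps R).

(* F_1, the series of order exactly 1. *)
Definition fps_F1 : set (fps R) := [set f | f 0%N = 0 /\ f 1%N != 0].

(* fps_comp_inv, fps_sqrt and B_function are definite descriptions with the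
   irrelevant default 0: the objects exist and are unique by fps_comp_invP and
   fps_comp_inv_unique (f in F_1), fps_sqrtP and fps_sqrt_unique (constant
   term 1), B_functionP and B_function_unique (f <> - z pseudo-involutory). *)
Definition fps_comp_inv f : fps R :=
  xget 0 [set g : fps R | [/\ g 0%N = 0, f \oS g = 'z & g \oS f = 'z]].

(* The square root with constant term 1, for f with constant term 1. *)
Definition fps_sqrt f : fps R := xget 0 [set s : fps R | s ^+ 2 = f /\ s 0%N = 1].

Definition pseudo_inv f : fps R := ((- 'z) \oS fps_comp_inv f) \oS (- 'z).

Definition pseudo_involutory f : Prop := fps_F1 f /\ pseudo_inv f = f.

(* sqrt (z f) = z sqrt (f / z), for f = z + O(z^2). *)
Definition sqrt_zf f : fps R := 'z * fps_sqrt (fps_divX f).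

Definition pseudo_half f : fps R := pseudo_inv (sqrt_zf f).

Definition B_function f : fps R :=
  xget 0 [set B : fps R | f - 'z = 'z * f * (B \oS ('z * f))].

Lemma fps_rec (step : (nat -> R) -> nat -> R) :
  (forall n u v, (forall k, (k < n)%N -> u k = v k) -> step u n = step v n) ->
  exists u : nat -> R, forall n, u n = step u n.
Proof.
move=> loc.
pose fix pre n : nat -> R := if n is m.+1 then
  (fun k => if k == m then step (pre m) m else pre m k) else (fun=> 0).
have preE n k : (k < n)%N -> pre n k = pre k.+1 k.
  elim: n => // n IH; rewrite ltnS leq_eqVlt => /orP[/eqP -> //|lt_kn].
  by rewrite /= (ltn_eqF lt_kn) IH.
have preS n : pre n.+1 n = step (pre n) n by rewrite /= eqxx.
exists (fun n => pre n.+1 n) => n; rewrite preS.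
by apply: loc => k; apply: preE.
Qed.

Lemma fps_mulI a f g m : a m != 0 -> (forall k, (k < m)%N -> a k = 0) ->
  a * f = a * g -> f = g.
Proof.
move=> am alow /eqP; rewrite -subr_eq0 -mulrBr => /eqP e0.
apply/eqP; rewrite -subr_eq0; apply/eqP; move: (f - g) e0 => b e0.
apply/fpsP => n; rewrite fps0E; elim/ltn_ind: n => n IH.
have : (a * b) (m + n)%N = 0 by rewrite e0.
rewrite fpsME; have lt_m : (m < (m + n).+1)%N by lia.
rewrite (bigD1 (Ordinal lt_m)) //= addKn big1 ?addr0 => [|i].
  by move/eqP; rewrite mulf_eq0 (negPf am) => /eqP.
rewrite -val_eqE /= => ne; have [lt_im|] := ltnP i m; first by rewrite alow ?mul0r.
rewrite leq_eqVlt eq_sym (negPf ne) /= => lt_mi.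
by rewrite IH ?mulr0 //; have := ltn_ord i; lia.
Qed.

Lemma fps_sqrt_unique s t : s ^+ 2 = t ^+ 2 -> s 0%N = 1 -> t 0%N = 1 -> s = t.
Proof.
move=> /eqP; rewrite -subr_eq0 subr_sqr mulrC => /eqP st s0 t0.
apply/eqP; rewrite -subr_eq0; apply/eqP.
apply: (@fps_mulI (s + t) _ _ 0) => //; last by rewrite st mulr0.
by rewrite fpsDE s0 t0 -mulr2n pnatr_eq0.
Qed.

Lemma fps_sqrtP f : f 0%N = 1 -> fps_sqrt f ^+ 2 = f /\ fps_sqrt f 0%N = 1.
Proof.
move=> f0; rewrite /fps_sqrt.
apply: (@xgetPex _ 0 [set s : fps R | s ^+ 2 = f /\ s 0%N = 1]).
pose step (u : nat -> R) n := if n is m.+1 then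
  (f n - \sum_(i < m) u i.+1 * u (m - i)%N) / 2 else 1.
have [|u uE] := @fps_rec step.
  case=> // n u v uv; congr ((_ - _) / _); apply: eq_bigr => i _.
  by have lt_i := ltn_ord i; rewrite !uv //; lia.
exists (FPS u); split; last exact: (uE 0%N).
apply/fpsP => -[|n]; rewrite expr2 fpsME /=.
  by rewrite big_ord1 /= (uE 0%N) /= mulr1 f0.
rewrite big_ord_recl big_ord_recr /= subn0 /bump /= add1n subnn (uE 0%N) /=.
rewrite mul1r mulr1 [u n.+1]uE /=.
rewrite [X in _ + (X + _)](_ : _ = \sum_(i < n) u i.+1 * u (n - i)%N).
  by field.
by apply: eq_bigr.
Qed.

Lemma F1_X : fps_F1 'z.
Proof. by split; rewrite // fpsXE oner_neq0. Qed.

Lemma F1_N f : fps_F1 f -> fps_F1 (- f).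
Proof. by case=> f0 f1; split; rewrite fpsNE ?f0 ?oppr0 ?oppr_eq0. Qed.

Lemma F1_comp f g : fps_F1 f -> fps_F1 g -> fps_F1 (f \oS g).
Proof.
case=> f0 f1 [g0 g1]; split; first by rewrite fps_comp0.
by rewrite fps_comp1 // mulf_neq0.
Qed.

Lemma fps_left_inv f : fps_F1 f -> exists2 g, fps_F1 g & g \oS f = 'z.
Proof.
case=> f0 f1; pose step (u : nat -> R) n :=
  ((n == 1)%:R - \sum_(k < n) u k * (f ^+ k) n) / (f 1%N) ^+ n.
have [|u uE] := @fps_rec step.
  by move=> n u v uv; congr ((_ - _) / _); apply: eq_bigr => i _; rewrite uv.
have u0 : u 0%N = 0 by rewrite uE /step big_ord0 subr0 mul0r.
have u1 : u 1%N = (f 1%N)^-1.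
  by rewrite uE /step big_ord1 u0 mul0r subr0 mul1r.
exists (FPS u); first by split; rewrite //= u1 invr_eq0.
apply/fpsP => n; rewrite fps_compE big_ord_recr /= fps_exp_diag //.
rewrite [u n]uE /step mulfVK ?expf_neq0 //.
by rewrite addrC subrK.
Qed.

Lemma fps_comp_invP f : fps_F1 f ->
  [/\ fps_F1 (fps_comp_inv f), f \oS fps_comp_inv f = 'z
    & fps_comp_inv f \oS f = 'z].
Proof.
move=> Ff; rewrite /fps_comp_inv; set P := (X in xget _ X).
have : P (xget 0 P).
  apply: xgetPex; have [g Fg gf] := fps_left_inv Ff.
  have [k Fk kg] := fps_left_inv Fg; exists g.
  have [[f0 _] [g0 _] [k0 _]] := And3 Ff Fg Fk.
  suff kf : k = f by split=> //; rewrite -kf.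
  by rewrite -[k]fps_compXr -gf -fps_compA // kg fps_comp_X.
case=> g0 fg gf; split=> //; split=> //; apply/eqP => g1.
have /fpsP/(_ 1%N) := gf; rewrite fps_comp1 ?(proj1 Ff) // g1 mul0r fpsXE.
by move/eqP; rewrite eq_sym oner_eq0.
Qed.

Lemma fps_comp_inv_unique f g : fps_F1 f -> g 0%N = 0 -> f \oS g = 'z ->
  g = fps_comp_inv f.
Proof.
move=> Ff g0 fg; have [[i0 _] _ jf] := fps_comp_invP Ff.
by rewrite -[g]fps_comp_X // -jf fps_compA ?(proj1 Ff) // fg fps_compXr.
Qed.

Lemma fps_compIr f a b : fps_F1 f -> a \oS f = b \oS f -> a = b.
Proof.
move=> Ff ab; have [[i0 _] fi _] := fps_comp_invP Ff.
by rewrite -[a]fps_compXr -[b]fps_compXr -fi -!fps_compA ?(proj1 Ff) // ab.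
Qed.

Lemma fps_comp_NXl f : f 0%N = 0 -> (- 'z) \oS f = - f.
Proof. by move=> f0; rewrite fps_compN fps_comp_X. Qed.

Lemma fps_NX_NX : (- 'z : fps R) \oS (- 'z) = 'z.
Proof. by rewrite fps_comp_NXl ?opprK // fpsNE oppr0. Qed.

Lemma pseudo_involutoryP f :
  pseudo_involutory f <-> fps_F1 f /\ (- f) \oS (- f) = 'z.
Proof.
have NX0 : (- 'z : fps R) 0%N = 0 by rewrite fpsNE oppr0.
have NXN f' : f' 0%N = 0 -> f' \oS (- 'z) \oS (- 'z) = f'.
  by move=> f'0; rewrite fps_compA // fps_NX_NX fps_compXr.
split=> -[Ff e]; split=> //; have [[i0 i1] fi ifE] := fps_comp_invP Ff.
  have f0 := proj1 Ff; have Nf0 : (- f) 0%N = 0 by rewrite fpsNE f0 oppr0.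
  have ei : - f = fps_comp_inv f \oS (- 'z).
    by rewrite -{1}e /pseudo_inv fps_comp_NXl // fps_compN opprK.
  by rewrite {2}ei fps_compN -fps_compA // fi fps_comp_X // opprK.
have f0 := proj1 Ff; have Nf0 : (- f) 0%N = 0 by rewrite fpsNE f0 oppr0.
have -> : pseudo_inv f = - (fps_comp_inv f \oS (- 'z)).
  by rewrite /pseudo_inv fps_comp_NXl // fps_compN.
suff <- : - (f \oS (- 'z)) = fps_comp_inv f by rewrite fps_compN NXN // opprK.
apply: fps_comp_inv_unique => //; first by rewrite fpsNE fps_comp0 f0 oppr0.
rewrite -fps_compN -fps_compA // -[f]opprK fps_compN opprK e.
by rewrite fps_comp_NXl // opprK.
Qed.

Lemma pseudo_involutory1 f : pseudo_involutory f -> f <> - 'z -> f 1%N = 1.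
Proof.
move=> /pseudo_involutoryP[Ff ff] fN; have [f0 f1] := Ff.
have Nf0 : (- f) 0%N = 0 by rewrite fpsNE f0 oppr0.
have : (f 1%N) ^+ 2 = 1.
  have /fpsP/(_ 1%N) := ff; rewrite fps_comp1 // !fpsNE mulrNN -expr2 => ->.
  by rewrite fpsXE.
move/eqP; rewrite sqrf_eq1 => /orP[/eqP //|/eqP f1N]; case: fN.
apply/eqP; rewrite -eqr_oppLR; apply/eqP.
pose u : fps R := - f + 'z.
have Fu : fps_F1 u.
  split; first by rewrite fpsDE fpsNE f0 oppr0 addr0.
  by rewrite fpsDE fpsNE f1N opprK fpsXE -mulr2n pnatr_eq0.
have uf : u \oS (- f) = u by rewrite fps_compD ff fps_comp_X // addrC.
have [[i0 _] _ iu] := fps_comp_invP Fu.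
rewrite -[LHS](@fps_comp_X R) // -iu fps_compA ?(proj1 Fu) //.
by rewrite uf.
Qed.

Lemma sqrt_zfP f : f 0%N = 0 -> f 1%N = 1 ->
  [/\ sqrt_zf f ^+ 2 = 'z * f, fps_F1 (sqrt_zf f) & sqrt_zf f 1%N = 1].
Proof.
move=> f0 f1; have [sq s0] := @fps_sqrtP (fps_divX f) f1.
have s1 : sqrt_zf f 1%N = 1 by rewrite fpsXM.
split=> //; last by split; rewrite ?s1 ?oner_neq0 // fpsXM.
by rewrite exprMn sq expr2 -mulrA fps_divXK.
Qed.

Lemma B_functionP f : pseudo_involutory f -> f <> - 'z ->
  f - 'z = 'z * f * (B_function f \oS ('z * f)).
Proof.
move=> pf fN; apply: (@xgetPex _ 0
  [set B : fps R | f - 'z = 'z * f * (B \oS ('z * f))]).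
have f1 := pseudo_involutory1 pf fN.
have [[f0 _] ff] := (pseudo_involutoryP f).1 pf.
have [s2 Fs s1] := sqrt_zfP f0 f1; have [s0 _] := Fs.
set s := sqrt_zf f in s2 Fs s1 s0.
have Nf0 : (- f) 0%N = 0 by rewrite fpsNE f0 oppr0.
have NX0 : (- 'z : fps R) 0%N = 0 by rewrite fpsNE oppr0.
have fNf : f \oS (- f) = - 'z by rewrite -ff fps_compN opprK.
have sNf : s \oS (- f) = - s.
  apply/eqP; rewrite -subr_eq0 opprK; apply/eqP.
  apply: (@fps_mulI (s \oS (- f) - s) _ _ 1).
  - by rewrite fpsBE fps_comp1 // fpsNE s1 f1 mul1r -opprD oppr_eq0 -mulr2n pnatr_eq0.
  - by case=> // _; rewrite fpsBE fps_comp0 subrr.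
  rewrite mulr0 -subr_sqr -fps_compXn // s2 fps_compM // fps_comp_X // fNf.
  by rewrite mulrNN mulrC subrr.
have [[i0 _] si is_] := fps_comp_invP Fs.
pose P := (f - 'z) \oS fps_comp_inv s.
have Ps : P \oS s = f - 'z by rewrite /P fps_compA // is_ fps_compXr.
have PN : P \oS (- 'z) = P.
  apply: (fps_compIr Fs); rewrite fps_compA // fps_comp_NXl // -sNf.
  by rewrite -fps_compA // Ps fps_compD fps_compN fNf fps_comp_X // opprK addrC.
have P0 : P 0%N = 0 by rewrite fps_comp0 fpsBE f0 subrr.
have X20 : ('z ^+ 2 : fps R) 0%N = 0 by rewrite fpsXn.
have Pdec := (fps_oddevenP (fps_odd P) (fps_even P) P0).2 (conj erefl erefl).
have XNX : ('z : fps R) ^+ 2 \oS (- 'z) = 'z ^+ 2.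
  by rewrite fps_compXn // fps_comp_X // sqrrN.
have Podd : fps_odd P = 0.
  have : P = 'z * (- fps_odd P \oS 'z ^+ 2) + 'z ^+ 2 * (fps_even P \oS 'z ^+ 2).
    rewrite -{1}PN {1}Pdec fps_compD !fps_compM // !fps_compA // XNX.
    by rewrite fps_comp_X // fps_compN mulrNN -expr2 mulNr mulrN.
  case/(fps_oddevenP _ _ P0) => oN _; apply/fpsP => n.
  have /fpsP/(_ n) /eqP := oN.
  by rewrite fpsNE -subr_eq0 -opprD oppr_eq0 -mulr2n mulrn_eq0 => /eqP.
exists (fps_even P); rewrite /mkset -Ps -s2 {1}Pdec Podd.
by rewrite fps_comp_zero mulr0 add0r fps_compM // fps_compA // fps_compXn // fps_comp_X //.
Qed.

Lemma B_function_unique f B : pseudo_involutory f -> f <> - 'z ->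
  f - 'z = 'z * f * (B \oS ('z * f)) -> B = B_function f.
Proof.
move=> pf fN BE; have := B_functionP pf fN; rewrite BE => eqB.
have f1 := pseudo_involutory1 pf fN; have [[f0 _] _] := pf.
have [s2 Fs _] := sqrt_zfP f0 f1; have [s0 _] := Fs.
have X20 : ('z ^+ 2 : fps R) 0%N = 0 by rewrite fpsXn.
have {eqB} : B \oS ('z * f) = B_function f \oS ('z * f).
  apply: (@fps_mulI ('z * f) _ _ 2) => //; first by rewrite fpsXM f1 oner_neq0.
  by case=> [|[|]] // _; rewrite fpsXM.
have -> : 'z * f = 'z ^+ 2 \oS sqrt_zf f by rewrite fps_compXn // fps_comp_X.
rewrite -!fps_compA // => /(fps_compIr Fs) e.
have h0 b : ('z ^+ 2 * (b \oS 'z ^+ 2) : fps R) 0%N = 0.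
  by rewrite fpsM0 X20 mul0r.
have dec b : 'z ^+ 2 * (b \oS 'z ^+ 2) =
  'z * (0 \oS 'z ^+ 2) + 'z ^+ 2 * (b \oS 'z ^+ 2) :> fps R.
  by rewrite fps_comp_zero mulr0 add0r.
have [_ ->] := (fps_oddevenP _ _ (h0 B)).1 (dec B).
have [_ ->] := (fps_oddevenP _ _ (h0 (B_function f))).1 (dec (B_function f)).
by rewrite e.
Qed.

End RealSeries.

(* Main.v *)
(* Write h = z o(z^2) + z^2 e(z^2) and k = - h(-z) = z o(z^2) - z^2 e(z^2).
   When f(k) = h, substituting k turns z f into k h = Q(z^2), where
   Q = z o^2 - z^2 e^2, and f - z into h - k = 2 z^2 e(z^2).  The equation
   f - z = (z B_f)(z f) thus becomes 2 z e = (z B_f)(Q).  The hypothesis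
   f = h o pseudo_inv h says exactly that f(k) = h, because k is the compositional
   inverse of pseudo_inv h.  For h the pseudo-half of f, k is the compositional
   inverse of s = sqrt (z f); then f(k) = h restates s(- f) = - s, which holds
   since both sides have square z f, and z f = s^2 gives Q = z. *)
Require Import Defs.
From mathcomp Require Import all_boot all_order all_algebra.
From mathcomp Require Import reals.
From mathcomp Require Import ring.

Import GRing.Theory.
Local Open Scope ring_scope.

Section OddEven.
Set Implicit Arguments.
Unset Strict Implicit.
Variable R : comNzRingType.
Implicit Types a b h : fps R.

Lemma fpsN0 h : h 0%N = 0 -> (- h) 0%N = 0.
Proof. by move=> h0; rewrite fpsNE h0 oppr0. Qed.

Lemma fps_oddevenE h : h 0%N = 0 ->
  h = 'z * (fps_odd h \oS 'z ^+ 2) + 'z ^+ 2 * (fps_even h \oS 'z ^+ 2).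
Proof. by move=> h0; apply/fps_oddevenP. Qed.

Lemma fps_oddevenNX h : h 0%N = 0 ->
  - (h \oS (- 'z)) =
  'z * (fps_odd h \oS 'z ^+ 2) - 'z ^+ 2 * (fps_even h \oS 'z ^+ 2).
Proof.
move=> h0; have X20 : ('z ^+ 2 : fps R) 0%N = 0 by rewrite fpsXn.
have NX0 : (- 'z : fps R) 0%N = 0 by apply: fpsN0.
rewrite {1}(fps_oddevenE h0) fps_compD !fps_compM // !fps_compA //.
by rewrite fps_compXn // fps_comp_X // sqrrN; ring.
Qed.

(** A series [c] is recovered from its composite with z^2 as the even part of z^2 c(z^2), so
    identities may be checked after substituting z^2. *)
Lemma fps_comp_X2I a b : a \oS 'z ^+ 2 = b \oS 'z ^+ 2 -> a = b.
Proof.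
have even_compX2 c : fps_even ('z ^+ 2 * (c \oS 'z ^+ 2)) = c.
  have c0 : ('z ^+ 2 * (c \oS 'z ^+ 2)) 0%N = 0 by rewrite fpsM0 fpsXn mul0r.
  have [|_ <- //] := (fps_oddevenP 0 c c0).1.
  by rewrite fps_comp_zero mulr0 add0r.
by move=> ab; rewrite -[a]even_compX2 ab even_compX2.
Qed.

End OddEven.

Section BFunction.
Set Implicit Arguments.
Unset Strict Implicit.
Variable R : realType.
Implicit Types f h : fps R.

Lemma sqrt_zf_compN f : pseudo_involutory f -> f <> - 'z ->
  sqrt_zf f \oS (- f) = - sqrt_zf f.
Proof.
move=> pf fN; have f1 := pseudo_involutory1 pf fN.
have [[f0 _] ff] := (pseudo_involutoryP f).1 pf.
have [s2 [s0 _] s1] := sqrt_zfP f0 f1; have Nf0 := fpsN0 f0.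
set s := sqrt_zf f in s2 s0 s1 *.
apply/eqP; rewrite -subr_eq0 opprK; apply/eqP.
(* The squares agree because f(- f) = - z, so (s(- f) - s)(s(- f) + s) = 0. The first factor has
   linear coefficient -2 and can be cancelled, which settles the sign. *)
apply: (@fps_mulI _ (s \oS (- f) - s) _ _ 1).
- by rewrite fpsBE fps_comp1 // fpsNE s1 f1 mul1r -opprD oppr_eq0 -mulr2n
             Num.Theory.pnatr_eq0.
- by case=> // _; rewrite fpsBE fps_comp0 subrr.
rewrite mulr0 -subr_sqr -fps_compXn // s2 fps_compM // fps_comp_X //.
by rewrite -[X in _ * X]opprK -fps_compN ff; ring.
Qed.

(** [pseudo_inv h] and k are the conjugates by the involution - z of the inverse of [h] and of [h],
    hence inverse to each other. *)
Lemma comp_pseudo_inv f h : fps_F1 h -> f = h \oS pseudo_inv h ->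
  f \oS (- (h \oS (- 'z))) = h.
Proof.
move=> Fh ->; have [[i0 _] _ ih] := fps_comp_invP Fh; have [h0 _] := Fh.
have NX0 : (- 'z : fps R) 0%N = 0 by apply: fpsN0.
have hNX0 : (h \oS (- 'z)) 0%N = 0 by rewrite fps_comp0.
have p0 : pseudo_inv h 0%N = 0.
  by rewrite /pseudo_inv !fps_comp0.
rewrite fps_compA ?fpsN0 // /pseudo_inv fps_comp_NXl // fps_compA ?fpsN0 //.
rewrite fps_comp_NXl ?fpsN0 // opprK fps_compN -fps_compA // ih.
by rewrite fps_comp_X // opprK fps_compXr.
Qed.

(** The product k h is a difference of squares, (z o(z^2))^2 - (z^2 e(z^2))^2, which is a series in
    z^2. *)
Lemma zf_comp_oddeven f h : h 0%N = 0 -> f \oS (- (h \oS (- 'z))) = h ->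
  ('z * f) \oS (- (h \oS (- 'z))) =
  ('z * fps_odd h ^+ 2 - 'z ^+ 2 * fps_even h ^+ 2) \oS 'z ^+ 2.
Proof.
move=> h0 fk; have X20 : ('z ^+ 2 : fps R) 0%N = 0 by rewrite fpsXn.
have k0 : (- (h \oS (- 'z))) 0%N = 0 by rewrite fpsN0 // fps_comp0.
rewrite fps_compM // fps_comp_X // fk fps_oddevenNX // {3}(fps_oddevenE h0).
by rewrite fps_compD fps_compN !fps_compM // fps_comp_X //; ring.
Qed.

Lemma B_function_comp_oddeven f h : pseudo_involutory f -> f <> - 'z ->
  h 0%N = 0 -> f \oS (- (h \oS (- 'z))) = h ->
  ('z * B_function f) \oS ('z * fps_odd h ^+ 2 - 'z ^+ 2 * fps_even h ^+ 2)
    = 2 * 'z * fps_even h.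
Proof.
move=> pf fN h0 fk; have X20 : ('z ^+ 2 : fps R) 0%N = 0 by rewrite fpsXn.
have k0 : (- (h \oS (- 'z))) 0%N = 0 by rewrite fpsN0 // fps_comp0.
have zf0 : ('z * f) 0%N = 0 by rewrite fpsM0 mul0r.
have Q0 : ('z * fps_odd h ^+ 2 - 'z ^+ 2 * fps_even h ^+ 2) 0%N = 0.
  by rewrite fpsBE !fpsM0 !mul0r subr0.
have e : ('z * B_function f) \oS ('z * f) = f - 'z.
  by rewrite fps_compM // fps_comp_X // -B_functionP.
(* After substituting z^2, Q(z^2) becomes (z f)(k), so the left side is (f - z)(k) = h - k. *)
apply: fps_comp_X2I; rewrite fps_compA // -(zf_comp_oddeven h0 fk) -fps_compA // e.
rewrite fps_compD fps_compN fk fps_comp_X // fps_oddevenNX //.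
rewrite {1}(fps_oddevenE h0) !fps_compM // fps_comp_X //.
(* The numeral [2] is composed as the sum [1 + 1]. *)
by rewrite (fps_compD 1 1) fps_comp_one; ring.
Qed.

Lemma pseudo_half_compNX f : pseudo_involutory f -> f <> - 'z ->
  - (pseudo_half f \oS (- 'z)) = fps_comp_inv (sqrt_zf f).
Proof.
move=> pf fN; have [[f0 _] _] := pf.
have [_ Fs _] := sqrt_zfP f0 (pseudo_involutory1 pf fN).
have [[i0 _] _ _] := fps_comp_invP Fs.
have NX0 : (- 'z : fps R) 0%N = 0 by apply: fpsN0.
rewrite /pseudo_half /pseudo_inv fps_comp_NXl // fps_compA //.
by rewrite fps_NX_NX fps_compXr opprK.
Qed.

Lemma comp_pseudo_half f : pseudo_involutory f -> f <> - 'z ->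
  f \oS (- (pseudo_half f \oS (- 'z))) = pseudo_half f.
Proof.
move=> pf fN; rewrite pseudo_half_compNX //; have [[f0 _] _] := pf.
have [_ Fs _] := sqrt_zfP f0 (pseudo_involutory1 pf fN).
have [[i0 _] si is_] := fps_comp_invP Fs; have [s0 _] := Fs.
have NX0 : (- 'z : fps R) 0%N = 0 by apply: fpsN0.
(* Apply the inverse of s on the left to s(- f) = - s. *)
have Nf : - f = fps_comp_inv (sqrt_zf f) \oS (- sqrt_zf f).
  by rewrite -sqrt_zf_compN // -fps_compA ?fpsN0 // is_ fps_comp_X // fpsN0.
rewrite -[X in X \oS _]opprK Nf fps_compN fps_compA ?fpsN0 // fps_compN si.
by rewrite /pseudo_half /pseudo_inv fps_comp_NXl // fps_compN.
Qed.

Lemma pseudo_half_oddeven f : pseudo_involutory f -> f <> - 'z ->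
  'z * fps_odd (pseudo_half f) ^+ 2 - 'z ^+ 2 * fps_even (pseudo_half f) ^+ 2
    = 'z.
Proof.
move=> pf fN; have [[f0 _] _] := pf.
have [s2 Fs _] := sqrt_zfP f0 (pseudo_involutory1 pf fN).
have [[i0 _] si _] := fps_comp_invP Fs.
(* Here k inverts s, so (z f)(k) = s(k)^2 = z^2. *)
apply: fps_comp_X2I; rewrite -(@zf_comp_oddeven f) ?comp_pseudo_half //.
  by rewrite pseudo_half_compNX // -s2 fps_compXn // si fps_comp_X // fpsXn.
by rewrite /pseudo_half /pseudo_inv !fps_comp0 fpsNE oppr0.
Qed.

(** This coefficient is the constant term of the odd part, and selects the branch of the square
    root. *)
Lemma pseudo_half1 f : pseudo_involutory f -> f <> - 'z ->
  pseudo_half f 1%N = 1.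
Proof.
move=> pf fN; have [[f0 _] _] := pf.
have [_ Fs s1] := sqrt_zfP f0 (pseudo_involutory1 pf fN).
have [[i0 _] si _] := fps_comp_invP Fs.
have NX0 : (- 'z : fps R) 0%N = 0 by apply: fpsN0.
have /fpsP/(_ 1%N) := si; rewrite fps_comp1 // s1 mul1r fpsXE => i1.
rewrite /pseudo_half /pseudo_inv !fps_comp1 // ?fps_comp0 //.
by rewrite i1 fpsNE fpsXE mulr1 mulrNN mulr1.
Qed.

Lemma fps_XI (a b : fps R) : 'z * a = 'z * b -> a = b.
Proof.
apply: (@fps_mulI _ _ _ _ 1); first by rewrite fpsXE oner_neq0.
by case.
Qed.

End BFunction.

Theorem theorem2p5 (R : realType) (f : fps R) :
  pseudo_involutory f -> f <> - 'z ->
  [/\ B_function f = 2 * fps_even (pseudo_half f),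
      fps_odd (pseudo_half f)
        = fps_sqrt (1 + 'z * fps_even (pseudo_half f) ^+ 2)
    & forall h : fps R, fps_F1 h -> f = h \oS pseudo_inv h ->
        'z * B_function f
          = (2 * 'z * fps_even h)
              \oS fps_comp_inv ('z * fps_odd h ^+ 2
                                - 'z ^+ 2 * fps_even h ^+ 2)].
Proof.
move=> pf fN; have hQ := pseudo_half_oddeven pf fN.
have h0 : pseudo_half f 0%N = 0.
  by rewrite /pseudo_half /pseudo_inv !fps_comp0 fpsNE oppr0.
split.
- have := B_function_comp_oddeven pf fN h0 (comp_pseudo_half pf fN).
  by rewrite hQ fps_compXr => e; apply: fps_XI; rewrite e; ring.
- set o := fps_odd _ in hQ *; set e := fps_even _ in hQ *.
  (* Divide Q = z by z. *)
  have o2 : o ^+ 2 = 1 + 'z * e ^+ 2.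
    by apply: fps_XI; rewrite mulrDr mulr1 -{2}hQ; ring.
  have [|sq sq0] := @fps_sqrtP _ (1 + 'z * e ^+ 2).
    by rewrite fpsDE fpsM0 mul0r addr0.
  apply: fps_sqrt_unique => //; first by rewrite sq o2.
  exact: pseudo_half1.
- move=> h Fh fh; have [{}h0 h1] := Fh.
  set Q := 'z * _ - _.
  have FQ : fps_F1 Q.
    split; first by rewrite fpsBE !fpsM0 !mul0r subr0.
    (* The term z^2 e^2 has order at least 2, so the linear coefficient of Q is that of z o^2,
       namely the square of [h 1]. *)
    rewrite fpsBE fpsXM fpsX0 [in X in _ - X]expr2 -mulrA !fpsXM subr0.
    exact: expf_neq0.
  have [[i0 _] Qi _] := fps_comp_invP FQ.
  rewrite -(B_function_comp_oddeven pf fN h0) ?comp_pseudo_inv //.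
  by rewrite fps_compA ?(proj1 FQ) // Qi fps_compXr.
Qed.
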